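(* For all integers $m\ge 0$ and $n\ge 0$, $\#U(m,n)=u(m,n)$.
   Context: A strongly unimodal sequence of weight $n$ is a sequence of positive integers $(a_1,\ldots,a_\ell)$ such that, for some $1\le k\le \ell$, $$a_1<\cdots<a_k>\cdots>a_\ell\ge 1,$$ and $\sum_i a_i=n$. Its rank is $\ell-2k+1$. $u(m,n)$ is the number of such sequences of weight $n$ and rank $m$. $m$-Durfee rectangle symbol of a partition $\lambda$. Set $\lambda_k=0$ for $k>\ell(\lambda)$. If $\ell(\lambda)\ge m+1$, let $$j=\max\{k:1\le k\le\ell(\lambda),\ \lambda_{k+m}\ge k\};$$ otherwise let $j=0$. Then $$\alpha=(\lambda_1-j,\ldots,\lambda_{m+j}-j)',$$ the conjugate of the partition formed by the positive entries, and $$\beta=(\lambda_{m+j+1},\ldots,\lambda_{\ell(\lambda)}).$$ This is written $\lambda=(\alpha,\beta)_{(m+j)\times j}$. By convention $\alpha_i=0$ for $i>\ell(\alpha)$ and $\beta_i=0$ for $i>\ell(\beta)$. $U(m,n)$ is the set of partitions $\lambda$ of $n$ whose $m$-Durfee rectangle symbol $(\alpha,\beta)_{(m+j)\times j}$ satisfies all of the following: (1) $\ell(\alpha)-\ell(\beta)\le -1$ if $m\ge 1$, and $\ell(\alpha)-\ell(\beta)\le 0$ if $m=0$; (2) $\alpha_1\le m+j-1$; (3) each of $1,2,\ldots,m-1$ appears as a part of $\alpha$. *)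

(* Defs.v *)
From HB Require Import structures.
From mathcomp Require Import all_boot all_order all_algebra.

Set Implicit Arguments.
Unset Strict Implicit.
Unset Printing Implicit Defensive.

Import Order.TTheory GRing.Theory Num.Theory.

Local Open Scope nat_scope.

(* A sequence of positive integers of sum n has at most n terms, each at most
   n, so such sequences all live in the finite type n.-bseq 'I_n.+1; the lemmas
   natseq_inj and natseq_surj say that no sequence is duplicated or missed. *)
Definition natseq (n : nat) (s : n.-bseq 'I_n.+1) : seq nat := map val s.

Definition pos_seq (n : nat) (s : seq nat) : bool :=
  all (fun x => 0 < x) s && (sumn s == n).

Lemma natseq_inj (n : nat) : injective (@natseq n).
Proof. by move=> s t /(inj_map val_inj) /val_inj. Qed.

Lemma natseq_surj (n : nat) (s : seq nat) :
  pos_seq n s -> exists t : n.-bseq 'I_n.+1, natseq t = s.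
Proof.
move=> /andP[s_gt0 /eqP sum_s].
have size_s : size s <= n.
  rewrite -sum_s; elim: s s_gt0 {sum_s} => //= x s IHs /andP[x_gt0 /IHs].
  by move=> le_s; rewrite -add1n leq_add.
have le_s : all (fun x => x < n.+1) s.
  apply/allP => x; rewrite ltnS -sum_s.
  elim: (s) => //= y r IHr; rewrite inE => /predU1P[-> | /IHr le_x].
    exact: leq_addr.
  exact: leq_trans le_x (leq_addl _ _).
have size_t : size (map (@inord n) s) <= n by rewrite size_map.
exists (Bseq size_t); rewrite /natseq /= -map_comp -[RHS]map_id.
by apply/eq_in_map => x /(allP le_s) lt_x /=; rewrite inordK.
Qed.

(* 1-based entry k of s, equal to 0 beyond the length of s. *)
Definition part (s : seq nat) (k : nat) : nat := nth 0 s k.-1.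

(* a_1 < ... < a_k > ... > a_l; the two sorted segments share the entry a_k. *)
Definition is_peak (a : seq nat) (k : nat) : bool :=
  [&& 1 <= k, k <= size a, sorted ltn (take k a) & sorted gtn (drop k.-1 a)].

Lemma is_peak_uniq (a : seq nat) (k l : nat) :
  is_peak a k -> is_peak a l -> k = l.
Proof.
suff main i j : is_peak a i -> is_peak a j -> ~~ (i < j).
  move=> Hk Hl; apply/eqP; rewrite eqn_leq leqNgt main //=.
  by rewrite leqNgt main.
case/and4P => i_gt0 _ _ /(sortedP 0) dec /and4P[_ j_le /(sortedP 0) inc _].
apply/negP => lt_ij; have lt_ia := leq_trans lt_ij j_le.
have := dec 0; rewrite size_drop !nth_drop addn0 addn1 prednK //.
rewrite ltn_subRL addn1 prednK // => /(_ lt_ia) /= gt_i.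
have := inc i.-1; rewrite size_takel // prednK // => /(_ lt_ij).
rewrite !nth_take ?prednK //; last exact: ltnW.
by move=> lt_i; have := ltn_trans lt_i gt_i; rewrite ltnn.
Qed.

(* A strongly unimodal sequence of weight n whose rank l - 2 k + 1 is m; by
   is_peak_uniq the peak position k, hence the rank, is unique. *)
Definition strongly_unimodal_rank (m : int) (n : nat) (a : seq nat) : bool :=
  pos_seq n a &&
  [exists k : 'I_(size a).+1,
     is_peak a k && ((size a)%:Z - 2%:Z * k%:Z + 1 == m)%R].

Definition u (m : int) (n : nat) : nat :=
  #|[set s : n.-bseq 'I_n.+1 | strongly_unimodal_rank m n (natseq s)]|.

Definition is_partition (n : nat) (lam : seq nat) : bool :=
  pos_seq n lam && sorted geq lam.

(* The conjugate of a partition mu, i.e. of a nonincreasing sequence. *)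
Definition conj_part (mu : seq nat) : seq nat :=
  [seq count (fun x => i <= x) mu | i <- iota 1 (part mu 1)].

Definition durfee (m : nat) (lam : seq nat) : nat :=
  if m.+1 <= size lam then
    \max_(1 <= k < (size lam).+1 | k <= part lam (k + m)) k
  else 0.

(* The truncated subtraction is harmless: for a partition, its entries
   1, ..., m + j are all at least j, by definition of j. *)
Definition durfee_alpha (m : nat) (lam : seq nat) : seq nat :=
  let j := durfee m lam in
  conj_part [seq x <- [seq part lam i - j | i <- iota 1 (m + j)] | 0 < x].

Definition durfee_beta (m : nat) (lam : seq nat) : seq nat :=
  drop (m + durfee m lam) lam.

(* Conditions (1) and (2) are read in int, so that none of the subtractions
   is truncated. *)
Definition in_U (m n : nat) (lam : seq nat) : bool :=
  let j := durfee m lam in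
  let alpha := durfee_alpha m lam in
  let beta := durfee_beta m lam in
  [&& is_partition n lam,
      ((size alpha)%:Z - (size beta)%:Z <= if m == 0%N then 0 else -1)%R,
      ((part alpha 1)%:Z <= m%:Z + j%:Z - 1)%R
    & all (fun i => i \in alpha) (iota 1 m.-1)].

Definition U (m n : nat) : {set n.-bseq 'I_n.+1} :=
  [set s | in_U m n (natseq s)].

(* Main.v *)
(* The bijection generalises Frobenius coordinates.  If lam in U(m, n) has an
   (m + j) x j Durfee rectangle, condition (2) says that row m + j has length
   exactly j.  Read off the strongly unimodal sequence
     a_t = lam'_(j+1-t) - m - (j - t)   for t = 1, ..., j  (columns),
     R_i = lam_i - max(i - m, 0)        for i = 1, ..., m + j - 1  (rows),
   with peak a_j.  Columns being weakly decreasing makes a_1 < ... < a_j, rows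
   being weakly decreasing makes R strictly decreasing from index m on,
   condition (3) makes it so before m, and condition (1) is R_1 < a_j.  The
   weight is preserved because a_t = t + #{x in beta : x > j - t}: the terms t
   make up for the corrections 1, ..., j subtracted from rows m + 1, ..., m + j. *)
Require Import Defs.
From mathcomp Require Import all_boot all_order all_algebra.
From mathcomp Require Import zify.

(** * Nonincreasing sequences and conjugation *)

Lemma all_drop (T : Type) (p : pred T) (k : nat) (s : seq T) : all p s -> all p (drop k s).
Proof. by rewrite -{1}(cat_take_drop k s) all_cat => /andP[]. Qed.

Lemma nth_sorted_geq {s : seq nat} {i j : nat} :
  sorted geq s -> i <= j -> nth 0 s j <= nth 0 s i.
Proof.
move=> s_sorted le_ij; have [lt_j|] := ltnP j (size s); last first.
  by move=> ?; rewrite nth_default.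
apply: (sorted_leq_nth (leT := geq)) => //.
- by move=> y x z /= le_yx le_zy; apply: leq_trans le_yx.
- exact: leqnn.
- exact: leq_ltn_trans lt_j.
Qed.

Lemma sorted_geqP {s : seq nat} :
  reflect (forall i, i.+1 < size s -> nth 0 s i.+1 <= nth 0 s i) (sorted geq s).
Proof. exact: sortedP. Qed.

(** The entries that are at least [v] form an initial segment of [s]; positivity of [v] keeps the
    default 0 past the end out of it. *)
Lemma ltn_count_geq (s : seq nat) (v i : nat) :
  sorted geq s -> 0 < v -> (i < count (leq v) s) = (v <= nth 0 s i).
Proof.
move=> s_sorted v_gt0; elim: s i s_sorted => [|x s IHs] i /=.
  by move=> _; rewrite nth_nil; lia.
move=> xs_sorted; have [le_vx|lt_xv] := leqP v x.
  case: i => [|i] //=; rewrite add1n ltnS IHs //; exact: path_sorted xs_sorted.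
have -> : count (leq v) s = 0.
  apply/eqP; rewrite eqn0Ngt -has_count; apply/hasPn => y y_s.
  have /allP/(_ _ y_s) /= := order_path_min (rev_trans leq_trans) xs_sorted.
  by rewrite -ltnNge => ?; apply: leq_ltn_trans lt_xv.
have := nth_sorted_geq (s := x :: s) (i := 0) (j := i) xs_sorted isT => /=.
lia.
Qed.

(** A partition is determined by its column lengths: level 1 gives the number of parts, then
    [ltn_count_geq] recovers each part. *)
Lemma eq_sorted_count (s t : seq nat) :
  sorted geq s -> sorted geq t -> all (leq 1) s -> all (leq 1) t ->
  (forall v, 0 < v -> count (leq v) s = count (leq v) t) -> s = t.
Proof.
move=> s_sorted t_sorted s_gt0 t_gt0 eq_count.
have eq_size : size s = size t.
  by have := eq_count 1 isT; rewrite !(eqP (etrans (esym (all_count _ _)) _)).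
apply: (eq_from_nth (x0 := 0)) => // i _; apply/eqP.
have le_nth v : 0 < v -> (v <= nth 0 s i) = (v <= nth 0 t i).
  by move=> v_gt0; rewrite -!ltn_count_geq // eq_count.
have := le_nth (nth 0 s i); have := le_nth (nth 0 t i); lia.
Qed.

Lemma count_iota_leq (x y : nat) :
  count (fun i => i <= x) (iota 1 y) = minn x y.
Proof.
elim: y => [|y IHy]; first by rewrite minn0.
by rewrite -[y.+1]addn1 iotaD count_cat IHy /= add1n; lia.
Qed.

(** This is the involutivity of conjugation, in terms of column lengths. *)
Lemma count_conj_part (mu : seq nat) (c : nat) :
  sorted geq mu -> 0 < c -> count (leq c) (conj_part mu) = part mu c.
Proof.
case: c => // c mu_sorted _; rewrite /conj_part count_map.
rewrite (eq_in_count (a2 := fun i => i <= nth 0 mu c)) => [|i /=].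
  by rewrite count_iota_leq; have := nth_sorted_geq mu_sorted (leq0n c); rewrite /part /=; lia.
by rewrite mem_iota => /andP[i_gt0 _]; rewrite ltn_count_geq.
Qed.

Lemma conj_part_sorted (mu : seq nat) : sorted geq (conj_part mu).
Proof.
apply: (homo_sorted (e := leq)) (iota_sorted 1 _) => i k le_ik.
by apply: sub_count => x; apply: leq_trans.
Qed.

Lemma conj_part_gt0 (mu : seq nat) : sorted geq mu -> all (leq 1) (conj_part mu).
Proof.
move=> mu_sorted; apply/allP => c /mapP[i]; rewrite mem_iota => /andP[i_gt0 le_i] ->.
by rewrite ltn_count_geq // -ltnS.
Qed.

(** Double count of the cells of a diagram; the bound [j] ensures that no column is missed. *)
Lemma sum_count_leq (j : nat) (s : seq nat) :
  all (geq j) s -> \sum_(i < j) count (leq i.+1) s = sumn s.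
Proof.
elim: s => [|x s IHs] /=; first by rewrite big1.
case/andP=> le_xj /IHs <-; rewrite big_split /=; congr (_ + _).
rewrite -(big_mkord xpredT (fun i => nat_of_bool (i < x))) (big_cat_nat (n := x)) //=.
rewrite [X in _ + X]big_nat [X in _ + X]big1 => [|i]; last by lia.
rewrite big_nat (eq_bigr (fun=> 1)); last by move=> i; lia.
rewrite -big_nat sum_nat_const_nat; lia.
Qed.

(** * Transfer of cardinality along a map of plain sequences *)

Lemma card_natseq_bij (n : nat) (P Q : pred (seq nat)) (f : seq nat -> seq nat) :
    (forall s, P s -> pos_seq n s) -> (forall s, Q s -> pos_seq n s) ->
    (forall s, P s -> Q (f s)) -> {in P &, injective f} ->
    (forall t, Q t -> exists2 s, P s & f s = t) ->
  #|[set s : n.-bseq 'I_n.+1 | P (natseq s)]|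
  = #|[set s : n.-bseq 'I_n.+1 | Q (natseq s)]|.
Proof.
move=> P_pos Q_pos fPQ f_inj f_surj.
(* [F] lifts [f] to the finite type; by [natseq_surj] the default [s] is never reached when
   [P (natseq s)] holds. *)
pose F s := odflt s [pick t : n.-bseq 'I_n.+1 | natseq t == f (natseq s)].
have FE s : P (natseq s) -> natseq (F s) = f (natseq s).
  move=> Ps; rewrite /F; case: pickP => [t /eqP //|no_t].
  have [t t_def] := natseq_surj (Q_pos _ (fPQ _ Ps)).
  by have := no_t t; rewrite t_def eqxx.
have F_inj : {in [set s | P (natseq s)] &, injective F}.
  move=> s t; rewrite !inE => Ps Pt eq_F; apply: natseq_inj.
  by apply: f_inj => //; rewrite -!FE // eq_F.
rewrite -(card_in_imset F_inj); apply: eq_card => t.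
rewrite [RHS]inE; apply/imsetP/idP => [[s]|Qt].
  by rewrite inE => Ps ->; rewrite FE //; apply: fPQ.
have [s Ps fs] := f_surj _ Qt; have [s' s'E] := natseq_surj (P_pos _ Ps).
by exists s'; rewrite ?inE ?s'E //; apply: natseq_inj; rewrite FE s'E.
Qed.

(** * Peaks and ranks *)

Lemma is_peakP (a : seq nat) (k : nat) :
  is_peak a k <->
  [/\ 0 < k <= size a, forall i, i.+1 < k -> nth 0 a i < nth 0 a i.+1
    & forall i, k <= i.+1 -> i.+1 < size a -> nth 0 a i.+1 < nth 0 a i].
Proof.
split.
  case/and4P=> k_gt0 le_k /(sortedP 0) inc /(sortedP 0) dec.
  split; first by rewrite k_gt0.
    move=> i lt_i; have := inc i; rewrite size_takel // !nth_take //; last exact: ltnW.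
    exact.
  move=> i le_ki lt_i; have := dec (i - k.-1); rewrite size_drop !nth_drop /=.
  have -> : k.-1 + (i - k.-1) = i by lia.
  have -> : k.-1 + (i - k.-1).+1 = i.+1 by lia.
  apply; lia.
case=> /andP[k_gt0 le_k] inc dec; apply/and4P; split=> //; apply/(sortedP 0) => i.
  by rewrite size_takel // => lt_i; rewrite !nth_take //; [exact: inc | exact: ltnW].
rewrite size_drop !nth_drop => lt_i /=; rewrite addnS; apply: dec; lia.
Qed.

Lemma strongly_unimodal_rankP (m n : nat) (a : seq nat) :
  strongly_unimodal_rank (Posz m) n a <->
  pos_seq n a /\ exists2 k, is_peak a k & size a + 1 = m + k.*2.
Proof.
rewrite /strongly_unimodal_rank; split.
  case/andP=> a_pos /existsP[k /andP[k_peak rk]]; split=> //.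
  by exists (k : nat) => //; move: rk => /eqP; lia.
case=> a_pos [k k_peak rk]; rewrite a_pos /=.
have /and3P[_ le_k _] := k_peak.
apply/existsP; exists (Ordinal (le_k : k < (size a).+1)); rewrite /= k_peak /=.
by apply/eqP; lia.
Qed.

(** * The Durfee rectangle and the conditions defining [U] *)

Lemma leq_part_durfee (m : nat) (lam : seq nat) :
  durfee m lam <= part lam (durfee m lam + m) \/ durfee m lam = 0.
Proof.
rewrite /durfee; case: ifP => _; last by right.
elim/big_ind: _ => [|x y|i]; [by right | | by left].
by rewrite /maxn; case: ifP.
Qed.

(** The value j is admissible, and for k > j row k + m lies below row m + j, so it has at most j < k
    cells. *)
Lemma durfee_eq {m j : nat} {lam : seq nat} :
  sorted geq lam -> 0 < j -> part lam (m + j) = j -> durfee m lam = j.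
Proof.
case: j => // j lam_sorted _; rewrite /part addnS /= => lam_j.
have lt_size : m + j < size lam.
  by rewrite ltnNge; apply/negP => ?; rewrite nth_default in lam_j.
rewrite /durfee ifT; last by lia.
apply/eqP; rewrite eqn_leq; apply/andP; split.
  apply/bigmax_leqP_seq => k _; rewrite leqNgt => le_k; apply/negP => lt_jk.
  have := @nth_sorted_geq lam (m + j) (k + m).-1 lam_sorted; rewrite /part in le_k.
  lia.
apply: (leq_bigmax_seq (F := id)); first by rewrite mem_index_iota; lia.
by rewrite /part addSn /= addnC lam_j.
Qed.

Lemma count_filter_gt0 (v : nat) (s : seq nat) :
  0 < v -> count (leq v) [seq x <- s | 0 < x] = count (leq v) s.
Proof. by move=> v_gt0; rewrite count_filter; apply: eq_count => x /=; lia. Qed.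

Lemma part1_filter_gt0 (s : seq nat) :
  sorted geq s -> part [seq x <- s | 0 < x] 1 = part s 1.
Proof.
case: s => // -[|x] s //= s_sorted; rewrite /part /=.
rewrite (eq_in_filter (a2 := pred0)) ?filter_pred0 // => y y_s.
have /allP/(_ _ y_s) /= := order_path_min (rev_trans leq_trans) s_sorted.
by case: y {y_s}.
Qed.

(** The columns of height exactly [i] are those reached by row [i] but not by row [i + 1], rows
    being numbered from 1. *)
Lemma mem_conj_part (mu : seq nat) (i : nat) :
  sorted geq mu -> 0 < i -> (i \in conj_part mu) = (nth 0 mu i < nth 0 mu i.-1).
Proof.
case: i => // i mu_sorted _; apply/mapP/idP => /= [[v] | lt_nth].
  rewrite mem_iota => /andP[v_gt0 _] eq_i; have {}eq_i : i.+1 = count (leq v) mu by [].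
  have := ltn_count_geq mu v i mu_sorted v_gt0.
  have := ltn_count_geq mu v i.+1 mu_sorted v_gt0.
  lia.
exists (nth 0 mu i).
  by rewrite mem_iota; have := nth_sorted_geq mu_sorted (leq0n i); rewrite /part /=; lia.
have nth_gt0 : 0 < nth 0 mu i by lia.
have := ltn_count_geq mu _ i mu_sorted nth_gt0.
have := ltn_count_geq mu _ i.+1 mu_sorted nth_gt0.
by move=> ? ?; change (i.+1 = count (leq (nth 0 mu i)) mu); lia.
Qed.

Lemma part1_conj_part (mu : seq nat) :
  sorted geq mu -> part (conj_part mu) 1 = count (leq 1) mu.
Proof.
move=> mu_sorted; rewrite /conj_part; case mu1: (part mu 1) => [|k] //=.
rewrite /part /= in mu1 *; have := ltn_count_geq mu 1 0 mu_sorted isT.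
by rewrite mu1; lia.
Qed.

(* Conditions (1), (2), (3) of [U] in terms of the rows of the partition are
   [shape_size], [shape_corner] and [shape_strict]; the corner condition alone
   forces [j] to be the size of the Durfee rectangle (see [durfee_eq]). *)
Record durfee_shape (m j : nat) (lam : seq nat) : Prop := DurfeeShape {
  shape_sorted : sorted geq lam;
  shape_gt0 : 0 < j;
  shape_corner : part lam (m + j) = j;
  shape_strict : forall i, 0 < i < m -> part lam i.+1 < part lam i;
  shape_size : part lam 1 + m + (m != 0) <= size lam
}.

Arguments shape_sorted {m j lam}.
Arguments shape_gt0 {m j lam}.
Arguments shape_corner {m j lam}.
Arguments shape_strict {m j lam}.
Arguments shape_size {m j lam}.

(** For a nonempty rectangle, alpha has lam_1 - j parts and beta has [size lam] - m - j, so j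
    cancels in (1). The largest part of alpha counts the rows longer than j among the first m + j,
    and its parts are the heights where these rows strictly drop. *)
Lemma in_U_shape (m n : nat) (lam : seq nat) :
  in_U m n lam <-> is_partition n lam /\ durfee_shape m (durfee m lam) lam.
Proof.
rewrite /in_U /durfee_alpha /durfee_beta; set j := durfee m lam.
have [lamP|] := boolP (is_partition n lam); last by move=> _; split=> [|[]].
rewrite /=; have /andP[/andP[lam_gt0 _] lam_sorted] := lamP.
set s := [seq part lam i - j | i <- iota 1 (m + j)].
have nth_s i : i < m + j -> nth 0 s i = nth 0 lam i - j.
  by move=> lt_i; rewrite (nth_map 0) ?size_iota // nth_iota.
have size_s : size s = m + j by rewrite size_map size_iota.
have s_sorted : sorted geq s.
  apply/sorted_geqP => i; rewrite size_s => lt_i; rewrite !nth_s //; last exact: ltnW.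
  by apply: leq_sub2r; apply: nth_sorted_geq.
set mu := [seq x <- s | 0 < x].
have mu_sorted : sorted geq mu by apply: sorted_filter => // y x z /=; lia.
have size_conj : size (conj_part mu) = part s 1.
  by rewrite size_map size_iota part1_filter_gt0.
rewrite size_conj size_drop part1_conj_part // count_filter_gt0 //.
(* Dropping zeros changes neither the first part nor the counts at positive levels, so [s] and [mu]
   have the same conjugate, and the indices of [s] match the rows of [lam]. *)
have mem_conj i : 0 < i -> (i \in conj_part mu) = (nth 0 s i < nth 0 s i.-1).
  move=> i_gt0; rewrite -mem_conj_part // /conj_part part1_filter_gt0 //.
  congr (_ \in _); apply/eq_in_map => v; rewrite mem_iota => /andP[v_gt0 _].
  by rewrite count_filter_gt0.
have j_le : 0 < j -> j <= part lam (m + j).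
  by have := leq_part_durfee m lam; rewrite -/j addnC; lia.
have j_gt0 : m < size lam -> 0 < j.
  move=> lt_m; rewrite /j /durfee ifT //.
  apply: (@leq_trans 1) => //; apply: (leq_bigmax_seq (F := id)).
    by rewrite mem_index_iota; lia.
  by rewrite /part add1n /=; apply: (allP lam_gt0); apply: mem_nth.
have count_s : count (leq 1) s <= size s by exact: count_size.
split.
  case/and3P=> size_le count_le /allP all_mem; split=> //.
  (* If j = 0 then beta is empty, which violates (1) when m >= 1, while (2) reads alpha_1 <= -1 when
     m = 0. *)
  have jpos : 0 < j.
    rewrite lt0n; apply/negP => /eqP j0.
    have : size lam <= m by rewrite leqNgt; apply/negP => /j_gt0; lia.
    case: (m) size_le count_le => [|m'] /=; lia.
  have mj : (m + j).-1 < m + j by lia.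
  (* By (2) the first m + j rows are not all longer than j, so the last of them is not. *)
  have corner : part lam (m + j) = j.
    apply/eqP; rewrite eqn_leq j_le // andbT /part.
    have := ltn_count_geq s 1 (m + j).-1 s_sorted isT; rewrite nth_s //.
    lia.
  have sz : m + j <= size lam.
    rewrite leqNgt; apply/negP => lt_mj; move: corner; rewrite /part nth_default; lia.
  have part_s1 : part s 1 = part lam 1 - j by rewrite /part nth_s //; lia.
  have : j <= part lam 1.
    by rewrite -{1}corner; apply: nth_sorted_geq.
  split=> //; last by case: (m) size_le part_s1 sz => [|m'] /=; lia.
  case=> // i /andP[_ lt_i]; have := all_mem i.+1.
  rewrite mem_iota mem_conj // !nth_s /part /=; lia.
case=> _ [_ jpos corner strict sz].
have le_j1 : j <= part lam 1 by rewrite -{1}corner; apply: nth_sorted_geq.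
have part_s1 : part s 1 = part lam 1 - j by rewrite /part nth_s //; lia.
have sz' : m + j <= size lam.
  rewrite leqNgt; apply/negP => lt_mj; move: corner; rewrite /part nth_default; lia.
apply/and3P; split.
- by case: (m) sz part_s1 sz' => [|m'] /=; lia.
- have := ltn_count_geq s 1 (m + j).-1 s_sorted isT; rewrite nth_s; last by lia.
  rewrite /part in corner; lia.
- apply/allP => i; rewrite mem_iota => /andP[i_gt0 lt_i]; rewrite mem_conj // !nth_s; try lia.
  case: i i_gt0 lt_i => // i _ lt_i; have := strict i.+1; rewrite /part /=.
  have : j <= nth 0 lam i.+1.
    by rewrite -{1}corner; apply: nth_sorted_geq => //; lia.
  lia.
Qed.

(** * The maps between partitions and unimodal sequences *)

(* The first [j] entries, indexed from 0, encode the first [j] columns of [lam]: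
   column [c] has length [m + c - 1] plus the entry of index [j - c]. *)
Definition unimodal_of_partition (m j : nat) (lam : seq nat) : seq nat :=
  mkseq (fun i => i.+1 + count (leq (j - i)) (drop (m + j) lam)) j
  ++ mkseq (fun i => nth 0 lam i - (i.+1 - m)) (m + j).-1.

(** When [a] has length m + 2k - 1, the last index of the first block falls just past the end of
    [a], where the default 0 makes row m + k equal to k. The second block is beta, rebuilt from its
    column lengths. *)
Definition partition_of_unimodal (m k : nat) (a : seq nat) : seq nat :=
  mkseq (fun i => nth 0 a (k + i) + (i.+1 - m)) (m + k)
  ++ conj_part (mkseq (fun c => nth 0 a (k.-1 - c) - (k - c)) k).

Lemma size_unimodal_of_partition (m j : nat) (lam : seq nat) :
  size (unimodal_of_partition m j lam) = j + (m + j).-1.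
Proof. by rewrite size_cat !size_mkseq. Qed.

Lemma nth_unimodal_left (m j : nat) (lam : seq nat) (i : nat) :
  i < j -> nth 0 (unimodal_of_partition m j lam) i
           = i.+1 + count (leq (j - i)) (drop (m + j) lam).
Proof. by move=> lt_i; rewrite nth_cat size_mkseq lt_i nth_mkseq. Qed.

Lemma nth_unimodal_right (m j : nat) (lam : seq nat) (i : nat) :
  i < (m + j).-1 -> nth 0 (unimodal_of_partition m j lam) (j + i)
                    = nth 0 lam i - (i.+1 - m).
Proof.
by move=> lt_i; rewrite nth_cat size_mkseq ifN -?leqNgt ?leq_addr // addKn nth_mkseq.
Qed.

Lemma shape_leq_size {m j : nat} {lam : seq nat} :
  durfee_shape m j lam -> m + j <= size lam.
Proof.
move=> lamS; have j_gt0 := shape_gt0 lamS.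
rewrite leqNgt; apply/negP => lt_mj; have := shape_corner lamS.
by rewrite /part nth_default; lia.
Qed.

Lemma shape_nth_ge {m j : nat} {lam : seq nat} {i : nat} :
  durfee_shape m j lam -> i < m + j -> j <= nth 0 lam i.
Proof.
move=> lamS lt_i; rewrite -{1}(shape_corner lamS).
by apply: nth_sorted_geq (shape_sorted lamS) _; lia.
Qed.

Lemma shape_beta_le {m j : nat} {lam : seq nat} :
  durfee_shape m j lam -> all (geq j) (drop (m + j) lam).
Proof.
move=> lamS; apply/(all_nthP 0) => i _; rewrite nth_drop /= -{2}(shape_corner lamS).
by apply: nth_sorted_geq (shape_sorted lamS) _; lia.
Qed.

(** * Weight and unimodality of the image *)

Lemma sumn_unimodal_of_partition {m j : nat} {lam : seq nat} :
  durfee_shape m j lam -> sumn (unimodal_of_partition m j lam) = sumn lam.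
Proof.
move=> lamS; have j_gt0 := shape_gt0 lamS.
have sumn_mkseq f k : sumn (mkseq f k) = \sum_(i < k) f i.
  by rewrite sumnE big_map -[k in iota 0 k]subn0 big_mkord.
rewrite sumn_cat !sumn_mkseq big_split /=.
rewrite -[X in _ = sumn X](cat_take_drop (m + j)) sumn_cat.
rewrite -(sum_count_leq _ _ (shape_beta_le lamS)).
(* Reversing the index turns the levels [j - i] into the levels [i.+1] of [sum_count_leq]. *)
rewrite [X in _ + X + _](reindex_inj rev_ord_inj) /=.
under [X in _ + X + _]eq_bigr => i _ do rewrite subKn //.
have -> : sumn (take (m + j) lam) = \sum_(i < m + j) nth 0 lam i.
  rewrite sumnE (big_nth 0) size_takel ?(shape_leq_size lamS) // big_mkord.
  by apply: eq_bigr => i _; rewrite nth_take.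
have -> : \sum_(i < m + j) nth 0 lam i =
    \sum_(i < m + j) (nth 0 lam i - (i.+1 - m)) + \sum_(i < m + j) (i.+1 - m).
  rewrite -big_split; apply: eq_bigr => i _ /=; rewrite subnK //.
  by have := shape_nth_ge lamS (ltn_ord i); have := ltn_ord i; lia.
have -> : \sum_(i < m + j) (i.+1 - m) = \sum_(i < j) i.+1.
  rewrite big_split_ord /= [X in X + _]big1 => [|i _]; last by have := ltn_ord i; lia.
  by rewrite add0n; apply: eq_bigr => i _; lia.
(* Row m + j contributes j - j = 0. *)
have -> : \sum_(i < m + j) (nth 0 lam i - (i.+1 - m)) =
    \sum_(i < (m + j).-1) (nth 0 lam i - (i.+1 - m)).
  transitivity (\sum_(i < (m + j).-1.+1) (nth 0 lam i - (i.+1 - m))).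
    by rewrite prednK //; lia.
  rewrite big_ord_recr /=.
  have -> : nth 0 lam (m + j).-1 = j by exact: shape_corner lamS.
  by lia.
by rewrite [LHS]addnC addnA.
Qed.

Lemma strongly_unimodal_of_partition {m j n : nat} {lam : seq nat} :
  durfee_shape m j lam -> is_partition n lam ->
  strongly_unimodal_rank (Posz m) n (unimodal_of_partition m j lam).
Proof.
move=> lamS /andP[/andP[lam_gt0 /eqP sum_lam] lam_sorted].
have j_gt0 := shape_gt0 lamS; apply/strongly_unimodal_rankP; split.
  rewrite /pos_seq (sumn_unimodal_of_partition lamS) sum_lam eqxx andbT all_cat.
  apply/andP; split; apply/(all_nthP 0) => i; rewrite size_mkseq => lt_i; rewrite nth_mkseq //.
  by have := @shape_nth_ge _ _ _ i lamS; lia.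
exists j; last by rewrite size_unimodal_of_partition; lia.
have count_beta : count (leq 1) (drop (m + j) lam) = size lam - (m + j).
  by rewrite -size_drop; apply/eqP; rewrite -all_count all_drop.
apply/is_peakP; split; first by rewrite size_unimodal_of_partition; lia.
  move=> i lt_i; rewrite !nth_unimodal_left //; last exact: ltnW.
  suff : count (leq (j - i)) (drop (m + j) lam)
         <= count (leq (j - i.+1)) (drop (m + j) lam) by lia.
  by apply: sub_count => x /=; lia.
move=> i le_ji; rewrite size_unimodal_of_partition => lt_i.
have [lt_ij|le_ji'] := ltnP i j.
  (* At the junction, the peak is [size lam] - m and the next entry is lam_1 - (1 - m) with
     truncated 1 - m, so [shape_size] gives the descent. *)
  have -> : i.+1 = j + 0 by lia.
  rewrite nth_unimodal_right ?nth_unimodal_left //; last by lia.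
  have -> : j - i = 1 by lia.
  rewrite count_beta; have := shape_size lamS; rewrite /part /=.
  have := @shape_nth_ge _ _ _ 0 lamS; have := shape_leq_size lamS.
  by case: (m) => [|m'] /=; lia.
(* Before row m the corrections vanish and [shape_strict] gives the descent; from row m on they grow
   by one per row. The bound by j prevents truncation. *)
have -> : i = j + (i - j) by lia.
rewrite -addnS !nth_unimodal_right; try lia.
have := @nth_sorted_geq lam (i - j) (i - j).+1 lam_sorted (leqnSn _).
have := shape_strict lamS (i - j).+1; rewrite /part /=.
have := @shape_nth_ge _ _ _ (i - j).+1 lamS.
lia.
Qed.

(** * Injectivity and surjectivity *)

(** The length m + 2j - 1 recovers j, the right half recovers all rows above row m + j, which itself
    is j, and the left half gives the column lengths of beta. *)
Lemma unimodal_of_partition_inj (m j j' : nat) (lam lam' : seq nat) :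
  durfee_shape m j lam -> all (leq 1) lam -> durfee_shape m j' lam' -> all (leq 1) lam' ->
  unimodal_of_partition m j lam = unimodal_of_partition m j' lam' -> lam = lam'.
Proof.
move=> S p S' p' eq_a.
have j_gt0 := shape_gt0 S; have j'_gt0 := shape_gt0 S'.
have jE : j' = j.
  by have := congr1 size eq_a; rewrite !size_unimodal_of_partition; lia.
subst j'.
rewrite -(cat_take_drop (m + j) lam) -(cat_take_drop (m + j) lam'); congr (_ ++ _).
  apply: (eq_from_nth (x0 := 0)); rewrite !size_takel ?shape_leq_size // => i lt_i.
  rewrite !nth_take //.
  have [lt_i'|le_i'] := ltnP i (m + j).-1.
    have := congr1 (nth 0 ^~ (j + i)) eq_a; rewrite /= !nth_unimodal_right //.
    have := shape_nth_ge S lt_i; have := shape_nth_ge S' lt_i.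
    lia.
  have -> : i = (m + j).-1 by lia.
  by have := shape_corner S; have := shape_corner S'; rewrite /part; lia.
apply: eq_sorted_count; try exact: all_drop.
- exact: drop_sorted (shape_sorted S).
- exact: drop_sorted (shape_sorted S').
move=> v v_gt0; have [le_vj|lt_jv] := leqP v j.
  have := congr1 (nth 0 ^~ (j - v)) eq_a; rewrite /= !nth_unimodal_left; try lia.
  by rewrite subKn //; lia.
have count0 s : all (geq j) s -> count (leq v) s = 0.
  move=> /allP s_le; apply/eqP; rewrite eqn0Ngt -has_count; apply/hasPn => x /s_le /=; lia.
by rewrite !count0 //; apply: shape_beta_le.
Qed.

Lemma unimodal_of_partition_surj (m k : nat) (a : seq nat) :
  is_peak a k -> all (leq 1) a -> size a + 1 = m + k.*2 ->
  [/\ durfee_shape m k (partition_of_unimodal m k a),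
      all (leq 1) (partition_of_unimodal m k a)
    & unimodal_of_partition m k (partition_of_unimodal m k a) = a].
Proof.
case/is_peakP=> /andP[k_gt0 le_k] inc dec a_gt0 size_a.
set nu := mkseq (fun c => nth 0 a (k.-1 - c) - (k - c)) k.
set lam := partition_of_unimodal m k a.
have lamE : lam = mkseq (fun i => nth 0 a (k + i) + (i.+1 - m)) (m + k) ++ conj_part nu by [].
have a_pos i : i < size a -> 0 < nth 0 a i by move=> lt_i; apply: (allP a_gt0); apply: mem_nth.
(* Strictly increasing positive integers satisfy a_t >= t, so the subtraction in [nu] is not
   truncated. *)
have a_ge i : i < k -> i.+1 <= nth 0 a i.
  elim: i => [|i IHi] lt_i; first by apply: a_pos; lia.
  by have := inc _ lt_i; have := IHi (ltnW lt_i); lia.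
have nu_sorted : sorted geq nu.
  apply/sorted_geqP => c; rewrite size_mkseq => lt_c; rewrite !nth_mkseq //; last exact: ltnW.
  have := inc (k.-1 - c.+1); have -> : (k.-1 - c.+1).+1 = k.-1 - c by lia.
  lia.
have size_conj : size (conj_part nu) = nth 0 a k.-1 - k.
  by rewrite size_map size_iota /part /= nth_mkseq // !subn0.
have nth_head i : i < m + k -> nth 0 lam i = nth 0 a (k + i) + (i.+1 - m).
  by move=> lt_i; rewrite lamE nth_cat size_mkseq lt_i nth_mkseq.
have nth_tail i : m + k <= i -> nth 0 lam i = nth 0 (conj_part nu) (i - (m + k)).
  by move=> le_i; rewrite lamE nth_cat size_mkseq ltnNge le_i.
have size_lam : size lam = m + k + (nth 0 a k.-1 - k).
  by rewrite lamE size_cat size_mkseq size_conj.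
have drop_lam : drop (m + k) lam = conj_part nu.
  by rewrite lamE drop_size_cat // size_mkseq.
(* The descent is extended to the default 0 just past the end of [a], from which row m + k is
   built. *)
have dec0 i : k <= i.+1 -> i < size a -> nth 0 a i.+1 < nth 0 a i.
  move=> le_i lt_i; have [lt_Si|le_Si] := ltnP i.+1 (size a); first exact: dec.
  by rewrite nth_default // a_pos.
have conj_le i : nth 0 (conj_part nu) i <= k.
  have [lt_i|le_i] := ltnP i (size (conj_part nu)); last by rewrite nth_default.
  have /mapP[v _ ->] := mem_nth 0 lt_i.
  by apply: leq_trans (count_size _ _) _; rewrite size_mkseq.
split.
- split=> //.
  + apply/sorted_geqP => i lt_i; have [lt_Si|le_Si] := ltnP i.+1 (m + k).
      rewrite !nth_head //; last exact: ltnW.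
      by have := dec0 (k + i); rewrite addnS; lia.
    rewrite nth_tail //; have [lt_i'|le_i'] := ltnP i (m + k).
      by rewrite nth_head //; have := conj_le (i.+1 - (m + k)); lia.
    rewrite nth_tail // subSn //.
    exact: nth_sorted_geq (conj_part_sorted _) (leqnSn _).
  + by rewrite /part nth_head ?nth_default; lia.
  + case=> // i /andP[_ lt_i]; rewrite /part /= !nth_head; try lia.
    by have := dec0 (k + i); rewrite addnS; lia.
  (* Here lam_1 = a_(k+1) + (1 - m), truncated, and [size lam] = m + a_k, so the claim amounts to
     a_(k+1) < a_k. *)
  + rewrite /part /= nth_head ?size_lam ?addn0; last by lia.
    have := dec0 k.-1; rewrite prednK //; have := a_ge k.-1; rewrite prednK //.
    by case: (m) => [|m'] /=; lia.
- rewrite lamE all_cat conj_part_gt0 // andbT.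
  apply/(all_nthP 0) => i; rewrite size_mkseq => lt_i; rewrite nth_mkseq //.
  by have := a_pos (k + i); lia.
apply: (eq_from_nth (x0 := 0)); rewrite size_unimodal_of_partition; first by lia.
move=> i lt_i; have [lt_ik|le_ki] := ltnP i k.
  rewrite nth_unimodal_left // drop_lam count_conj_part //; last by lia.
  rewrite /part nth_mkseq; last by lia.
  have -> : k.-1 - (k - i).-1 = i by lia.
  by have := a_ge i; lia.
have -> : i = k + (i - k) by lia.
rewrite nth_unimodal_right; last by lia.
by rewrite nth_head; lia.
Qed.

Theorem theorem2p4 (m n : nat) : #|U m n| = u (Posz m) n.
Proof.
apply: (@card_natseq_bij n (in_U m n) (strongly_unimodal_rank (Posz m) n)
          (fun lam => unimodal_of_partition m (durfee m lam) lam)).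
- by move=> lam /in_U_shape[/andP[]].
- by move=> a /andP[].
- move=> lam /in_U_shape[lamP lamS]; exact: strongly_unimodal_of_partition.
- move=> lam lam' /in_U_shape[/andP[/andP[p _] _] S] /in_U_shape[/andP[/andP[p' _] _] S'].
  exact: unimodal_of_partition_inj.
move=> a /strongly_unimodal_rankP[/andP[a_gt0 sum_a] [k k_peak size_a]].
have [S p eq_a] := unimodal_of_partition_surj m k a k_peak a_gt0 size_a.
(* The map uses [durfee m lam], which has to be identified with the peak position [k] before [eq_a]
   applies. *)
have durfeeE := durfee_eq (shape_sorted S) (shape_gt0 S) (shape_corner S).
exists (partition_of_unimodal m k a); last by rewrite durfeeE.
apply/in_U_shape; rewrite durfeeE; split=> //; rewrite /is_partition (shape_sorted S) andbT.
by rewrite /pos_seq p -(sumn_unimodal_of_partition S) eq_a sum_a.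
Qed.
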